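(* Given an oracle that computes $\alpha$-approximate solutions to the (symmetric) undirected shortest transshipment problem, one can compute primal and dual feasible solutions $x,y$ to the asymmetric shortest transshipment problem $\min\{p(W_*x):Ax=b\}=\max\{b^Ty:q(R_*A^Ty)\le1\}$ satisfying $p(W_*x)\le(1+\epsilon)b^Ty$ using $\tilde O(\epsilon^{-3}\alpha^2\lambda^4)$ oracle calls.
   Context: $G=(V,E)$ connected undirected graph, $n$ nodes, $m$ edges, positive integer weights $w^+,w^-\in\mathbb{Z}_{\ge1}^m$, demand $b\in\mathbb{Z}^n$. Each edge is oriented $(u,v)$ with $w^+\ge w^-$ (using it from $u$ to $v$ costs $w^+$, from $v$ to $u$ costs $w^-$). $A$ is the $n\times m$ node-arc incidence matrix (column of $(u,v)$: $+1$ at $v$, $-1$ at $u$). $W_\pm=\mathrm{diag}(w^\pm)$, $W_*=[W_+\;\;-W_-]^T$, $R_*=[W_+^{-1}\;\;-W_-^{-1}]^T$. For $v\in\mathbb{R}^d$: $p(v)=\sum_i\max\{0,v_i\}$, $q(v)=\max\{0,\max_iv_i\}$. $\lambda:=\max_ew^+_e/w^-_e$. The symmetric undirected shortest transshipment problem with weights $w\ge1$ and demand $d$ is $\min\{\|Wx\|_1:Ax=d\}=\max\{d^Ty:\|W^{-1}A^Ty\|_\infty\le1\}$, $W=\mathrm{diag}(w)$; an $\alpha$-approximate solution is a feasible primal/dual pair within factor $\alpha$ of optimal. $\tilde O$ hides polylogarithmic factors in $n$. *)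

(* Defs.v *)
From HB Require Import structures.
From mathcomp Require Import all_boot all_order all_algebra.
From mathcomp Require Import reals sequences exp.

Set Implicit Arguments.
Unset Strict Implicit.
Unset Printing Implicit Defensive.

Import Order.TTheory GRing.Theory Num.Theory.
Local Open Scope ring_scope.

(* A connected simple undirected graph on 'I_n whose m edges carry a reference
   orientation, edge e being written (etail e, ehead e).  Simplicity matters for
   the complexity bound: it gives log m = O(log n). *)
Record graph (n m : nat) := Graph {
  etail : 'I_m -> 'I_n;
  ehead : 'I_m -> 'I_n;
  graph_nonempty : (0 < n)%N;
  graph_loopless : forall e, etail e != ehead e;
  graph_simple : forall e f,
    [set etail e; ehead e] = [set etail f; ehead f] -> e = f;
  graph_connected : forall u v,
    connect [rel u' v' | [exists e, [set etail e; ehead e] == [set u'; v']]] u v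
}.

Definition incidence (R : realType) (n m : nat) (G : graph n m) :
    'M[R]_(n, m) :=
  \matrix_(i, e) ((i == ehead G e)%:R - (i == etail G e)%:R).

Section Norms.
Variables (R : realType) (d : nat).
Implicit Type v : 'cV[R]_d.

Definition norm1 v : R := \sum_i `|v i 0|.
Definition norm_oo v : R := \big[Num.max/0]_i `|v i 0|.
Definition pfun v : R := \sum_i Num.max 0 (v i 0).
Definition qfun v : R := \big[Num.max/0]_i v i 0.
Definition dot v (u : 'cV[R]_d) : R := \sum_i v i 0 * u i 0.
Definition diagw v : 'M[R]_d := diag_mx v^T.
End Norms.

Section Transshipment.
Variables (R : realType) (n m : nat) (A : 'M[R]_(n, m)).

Definition sym_primal_feasible (d : 'cV[R]_n) (x : 'cV[R]_m) := A *m x = d.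

Definition sym_dual_feasible (w : 'cV[R]_m) (y : 'cV[R]_n) :=
  norm_oo (invmx (diagw w) *m (A^T *m y)) <= 1.

(* By weak duality  dot d y <= OPT <= norm1 (diagw w *m x)  for every feasible
   pair, with equality throughout exactly when the pair is optimal; so the pair is
   within a factor alpha of optimal when its two values are within a factor
   alpha of each other.  This is the certificate also demanded, with 1 + eps in
   place of alpha, of the final answer. *)
Definition sym_approx (alpha : R) (w : 'cV[R]_m) (d : 'cV[R]_n)
    (x : 'cV[R]_m) (y : 'cV[R]_n) :=
  [/\ sym_primal_feasible d x,
      sym_dual_feasible w y &
      norm1 (diagw w *m x) <= alpha * dot d y].

Definition oracle_type := 'cV[R]_m -> 'cV[R]_n -> 'cV[R]_m * 'cV[R]_n.

(* Since the graph is connected, the instance with demand d is feasible iff the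
   entries of d sum to 0. *)
Definition approx_oracle (alpha : R) (O : oracle_type) :=
  forall (w : 'cV[R]_m) (d : 'cV[R]_n),
    (forall e, 1 <= w e 0) -> \sum_i d i 0 = 0 ->
    sym_approx alpha w d (O w d).1 (O w d).2.

Definition Wstar (wp wm : 'cV[R]_m) : 'M[R]_(m + m, m) :=
  (row_mx (diagw wp) (- diagw wm))^T.

Definition Rstar (wp wm : 'cV[R]_m) : 'M[R]_(m + m, m) :=
  (row_mx (invmx (diagw wp)) (- invmx (diagw wm)))^T.

Definition asym_cost (wp wm x : 'cV[R]_m) : R := pfun (Wstar wp wm *m x).

Definition asym_primal_feasible (b : 'cV[R]_n) (x : 'cV[R]_m) := A *m x = b.

Definition asym_dual_feasible (wp wm : 'cV[R]_m) (y : 'cV[R]_n) :=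
  qfun (Rstar wp wm *m (A^T *m y)) <= 1.
End Transshipment.

(* The weights satisfy wp >= wm, so every ratio is at least 1 and the base
   value 1 only matters for the edgeless graph on one node. *)
Definition asymmetry (R : realType) (m : nat) (wp wm : 'cV[R]_m) : R :=
  \big[Num.max/1]_e (wp e 0 / wm e 0).

(* Programs of a real-number machine with scalar registers, node registers
   (vectors in R^n) and edge registers (vectors in R^m).  A program is a finite
   piece of syntax independent of the instance; it sees the graph only through
   products with A and A^T and through the oracle.  Every instruction performs
   O(n + m) scalar operations.  Charging for these steps is essential: as
   the transshipment problem can be solved without any oracle, a bound on the
   oracle calls alone would be vacuous. *)
Inductive unop := Exp | Ln.
Inductive binop := Add | Sub | Mul | Div | Max | Min.

(* The first argument is always the target register. *)
Inductive instr :=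
| SConst of nat & int
| SUn of unop & nat & nat
| SBin of binop & nat & nat & nat
| NFill of nat & nat
| NUn of unop & nat & nat
| NBin of binop & nat & nat & nat
| NSum of nat & nat
| NMax of nat & nat
| EFill of nat & nat
| EUn of unop & nat & nat
| EBin of binop & nat & nat & nat
| ESum of nat & nat
| EMax of nat & nat
| MulA of nat & nat
| MulAT of nat & nat.

(* [Call w d x y] queries the oracle with the weights in edge register w and
   the demand in node register d, and stores the answer in edge register x and
   node register y.  [If i j] and [While i j] test whether scalar register i is
   at most scalar register j. *)
Inductive prog :=
| Instr of instr
| Call of nat & nat & nat & nat
| Seq of prog & prog
| If of nat & nat & prog & prog
| While of nat & nat & prog.

Section Semantics.
Variables (R : realType) (n m : nat) (A : 'M[R]_(n, m)) (O : oracle_type R n m).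

Record state := State {
  sreg : nat -> R;
  nreg : nat -> 'cV[R]_n;
  ereg : nat -> 'cV[R]_m
}.

Definition upd (T : Type) (f : nat -> T) (i : nat) (a : T) : nat -> T :=
  fun j => if j == i then a else f j.

Definition set_s st i a := State (upd (sreg st) i a) (nreg st) (ereg st).
Definition set_n st i a := State (sreg st) (upd (nreg st) i a) (ereg st).
Definition set_e st i a := State (sreg st) (nreg st) (upd (ereg st) i a).

Definition eval_un (f : unop) : R -> R :=
  match f with Exp => @expR R | Ln => @ln R end.

Definition eval_bin (f : binop) (a c : R) : R :=
  match f with
  | Add => a + c
  | Sub => a - c
  | Mul => a * c
  | Div => a / c
  | Max => Num.max a c
  | Min => Num.min a c
  end.

Definition step (c : instr) (st : state) : state :=
  match c with
  | SConst i z => set_s st i z%:~R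
  | SUn f i j => set_s st i (eval_un f (sreg st j))
  | SBin f i j k => set_s st i (eval_bin f (sreg st j) (sreg st k))
  | NFill i j => set_n st i (const_mx (sreg st j))
  | NUn f i j => set_n st i (map_mx (eval_un f) (nreg st j))
  | NBin f i j k => set_n st i (map2_mx (eval_bin f) (nreg st j) (nreg st k))
  | NSum i j => set_s st i (\sum_v nreg st j v 0)
  | NMax i j => set_s st i (qfun (nreg st j))
  | EFill i j => set_e st i (const_mx (sreg st j))
  | EUn f i j => set_e st i (map_mx (eval_un f) (ereg st j))
  | EBin f i j k => set_e st i (map2_mx (eval_bin f) (ereg st j) (ereg st k))
  | ESum i j => set_s st i (\sum_e ereg st j e 0)
  | EMax i j => set_s st i (qfun (ereg st j))
  | MulA i j => set_n st i (A *m ereg st j)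
  | MulAT i j => set_e st i (A^T *m nreg st j)
  end.

(* [exec P st st' calls ops]: started in st, P halts in st' after [calls] oracle
   calls and [ops] steps in total (instructions, tests and oracle calls). *)
Inductive exec : prog -> state -> state -> nat -> nat -> Prop :=
| exec_instr c st : exec (Instr c) st (step c st) 0 1
| exec_call w d x y st :
    let xy := O (ereg st w) (nreg st d) in
    exec (Call w d x y) st (set_n (set_e st x xy.1) y xy.2) 1 1
| exec_seq P Q st st1 st2 k1 k2 t1 t2 :
    exec P st st1 k1 t1 -> exec Q st1 st2 k2 t2 ->
    exec (Seq P Q) st st2 (k1 + k2) (t1 + t2)
| exec_if_true i j P Q st st' k t :
    sreg st i <= sreg st j -> exec P st st' k t ->
    exec (If i j P Q) st st' k t.+1
| exec_if_false i j P Q st st' k t :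
    sreg st j < sreg st i -> exec Q st st' k t ->
    exec (If i j P Q) st st' k t.+1
| exec_while_true i j P st st1 st2 k1 k2 t1 t2 :
    sreg st i <= sreg st j -> exec P st st1 k1 t1 ->
    exec (While i j P) st1 st2 k2 t2 ->
    exec (While i j P) st st2 (k1 + k2) (t1 + t2).+1
| exec_while_false i j P st :
    sreg st j < sreg st i -> exec (While i j P) st st 0 1.

Definition init_state (eps alpha : R) (wp wm : 'cV[R]_m) (b : 'cV[R]_n) :=
  State (nth 0 [:: eps; alpha]) (nth 0 [:: b]) (nth 0 [:: wp; wm]).

Definition out_x (st : state) : 'cV[R]_m := ereg st 0%N.
Definition out_y (st : state) : 'cV[R]_n := nreg st 0%N.
End Semantics.

(* 1 + ln n instead of ln n, so that n = 1 is covered as well. *)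
Definition call_bound (R : realType) (C : R) (k n : nat) (eps alpha lam : R) :=
  C * (1 + ln n%:R) ^+ k * (eps ^- 3 * alpha ^+ 2 * lam ^+ 4).

(* Main.v *)
Require Import Defs.
From HB Require Import structures.
From mathcomp Require Import all_boot all_order all_algebra.
From mathcomp Require Import reals sequences exp.
From mathcomp Require Import ring lra.

Set Implicit Arguments.
Unset Strict Implicit.
Unset Printing Implicit Defensive.

Import Order.TTheory GRing.Theory Num.Theory.
Local Open Scope ring_scope.

(* Multiplicative weights on the dual.  For u = A^T Y let Z(u) be the sum over the
   edges of wp/(wp+wm) exp(eta u/wp) + wm/(wp+wm) exp(-eta u/wm), and let f be its
   normalised gradient: a flow of asymmetric cost at most 1.  Given a guess s of
   the optimum, query the oracle with weights wm on the residual demand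
   b - s A f.  If the returned flow x costs at most e s, then x + s f is feasible
   of cost at most (1 + e) s, and s is divided by 1 + e.  Otherwise the returned y
   satisfies b.y / s - f.(A^T y) > e / (alpha lam), and adding it to Y multiplies
   Phi = Z exp(-eta b.Y / s) by at most exp(-2 eta^2), for
   eta = e / (4 alpha lam).  The loop stops as soon as Y certifies b.Y > s q(Y).

   Phi starts at m and stays at least 1/(1 + lam) until then, so there are
   O(alpha^2 lam^2 (lam + ln m) / e^2) updates of Y.  Since Z >= m always,
   Phi <= m forces b.Y >= 0, so lowering s never increases Phi and a single run
   serves all guesses; weak duality against the first oracle answer leaves room
   for only O(alpha lam / e) values of s. *)

(** * Exponential estimate and coordinate forms of norms and dot products *)

(** Since [1 - z <= expR (- z)], the product [(1 - z) * expR z] is at most 1, while (1 - z)(1 + z +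
    2z^2) = 1 + z^2(1 - 2z) is at least 1 for z <= 1/2. *)
Lemma expR_le_quadratic (R : realType) (z : R) :
  z <= 1 / 2 -> expR z <= 1 + z + 2 * z ^+ 2.
Proof.
move=> hz; have h1 := expR_ge1Dx (- z); rewrite expRN in h1.
have hE := expR_gt0 z.
have h2 : (1 - z) * expR z <= 1.
  by have := ler_wpM2r (ltW hE) h1; rewrite mulVf ?gt_eqF.
have h3 : (1 - z) * expR z <= (1 - z) * (1 + z + 2 * z ^+ 2).
  apply: (le_trans h2); rewrite -subr_ge0.
  have -> : (1 - z) * (1 + z + 2 * z ^+ 2) - 1 = z ^+ 2 * (1 - 2 * z) by ring.
  by rewrite mulr_ge0 ?sqr_ge0 //; lra.
by rewrite ler_pM2l // in h3; lra.
Qed.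

Section DiagonalScaling.
Variables (R : realType) (m : nat) (w : 'cV[R]_m).
Hypothesis w_gt0 : forall e, 0 < w e 0.

Lemma diagw_mulE (v : 'cV[R]_m) e : (diagw w *m v) e 0 = w e 0 * v e 0.
Proof. by rewrite /diagw mul_diag_mx !mxE. Qed.

Lemma invmx_diagw_mulE (v : 'cV[R]_m) e :
  (invmx (diagw w) *m v) e 0 = v e 0 / w e 0.
Proof.
have wU : diagw w \in unitmx.
  rewrite unitmxE /diagw det_diag unitfE prodf_seq_neq0.
  by apply/allP => i _; rewrite /= mxE gt_eqF.
have {1}-> : v = diagw w *m (\col_i (v i 0 / w i 0)).
  apply/matrixP => i j; rewrite ord1 diagw_mulE mxE mulrCA divff ?mulr1 //.
  by rewrite gt_eqF.
by rewrite mulKmx // mxE.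
Qed.

Lemma norm1_diagw (x : 'cV[R]_m) :
  norm1 (diagw w *m x) = \sum_e w e 0 * `|x e 0|.
Proof.
by apply: eq_bigr => e _; rewrite diagw_mulE normrM (gtr0_norm (w_gt0 e)).
Qed.

Lemma sym_dual_feasible_edge (n : nat) (A : 'M[R]_(n, m)) (y : 'cV[R]_n) :
  sym_dual_feasible A w y -> forall e, `|(A^T *m y) e 0| <= w e 0.
Proof.
move=> hy e; have /bigmax_leP[_ /(_ e isT)] := hy.
by rewrite invmx_diagw_mulE normf_div (gtr0_norm (w_gt0 e)) ler_pdivrMr // mul1r.
Qed.
End DiagonalScaling.

Lemma trmx_diagw (R : realType) (m : nat) (w : 'cV[R]_m) :
  (diagw w)^T = diagw w.
Proof. by rewrite /diagw tr_diag_mx. Qed.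

Lemma dot_mulmx (R : realType) (n m : nat) (A : 'M[R]_(n, m))
    (x : 'cV[R]_m) (y : 'cV[R]_n) : dot (A *m x) y = dot x (A^T *m y).
Proof.
rewrite /dot (eq_bigr (fun i => \sum_e A i e * x e 0 * y i 0)); last first.
  by move=> i _; rewrite mxE mulr_suml.
rewrite exchange_big /=; apply: eq_bigr => e _.
by rewrite mxE mulr_sumr; apply: eq_bigr => i _; rewrite mxE mulrCA mulrA.
Qed.

Lemma dotDr (R : realType) (n : nat) (b y z : 'cV[R]_n) :
  dot b (y + z) = dot b y + dot b z.
Proof.
by rewrite /dot -big_split; apply: eq_bigr => i _; rewrite mxE mulrDr.
Qed.

Lemma dotZr (R : realType) (n : nat) (b y : 'cV[R]_n) c :
  dot b (c *: y) = c * dot b y.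
Proof.
by rewrite /dot mulr_sumr; apply: eq_bigr => i _; rewrite mxE mulrCA.
Qed.

(** * Asymmetric cost, dual feasibility and weak duality *)

Section Asymmetric.
Variables (R : realType) (n m : nat) (A : 'M[R]_(n, m)) (wp wm : 'cV[R]_m).
Hypothesis wm_gt0 : forall e, 0 < wm e 0.
Hypothesis wm_le_wp : forall e, wm e 0 <= wp e 0.

Let wp_gt0 e : 0 < wp e 0.
Proof. exact: lt_le_trans (wm_gt0 e) (wm_le_wp e). Qed.

(** Joint contribution of coordinates e and m + e of [Wstar wp wm *m x]. *)
Definition edge_cost (x : 'cV[R]_m) (e : 'I_m) : R :=
  Num.max 0 (wp e 0 * x e 0) + Num.max 0 (- (wm e 0 * x e 0)).

Lemma asym_costE (x : 'cV[R]_m) : asym_cost wp wm x = \sum_e edge_cost x e.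
Proof.
rewrite /asym_cost /pfun /Wstar tr_row_mx linearN /= !trmx_diagw.
rewrite mul_col_mx big_split_ord /= big_split /=; congr (_ + _).
  by apply: eq_bigr => e _; rewrite col_mxEu diagw_mulE.
by apply: eq_bigr => e _; rewrite col_mxEd mulNmx mxE diagw_mulE.
Qed.

Lemma trmx_invmx_diagw (w : 'cV[R]_m) :
  (invmx (diagw w))^T = invmx (diagw w).
Proof. by rewrite trmx_inv trmx_diagw. Qed.

Lemma asym_dual_feasibleP (y : 'cV[R]_n) :
  (forall e, - wm e 0 <= (A^T *m y) e 0 <= wp e 0) ->
  asym_dual_feasible A wp wm y.
Proof.
move=> hy; rewrite /asym_dual_feasible /Rstar tr_row_mx linearN /=.
rewrite !trmx_invmx_diagw mul_col_mx; apply/bigmax_leP; split=> // i _.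
case: (split_ordP i) => e ->.
  rewrite col_mxEu invmx_diagw_mulE // ler_pdivrMr // mul1r.
  by case/andP: (hy e).
rewrite col_mxEd mulNmx mxE invmx_diagw_mulE // -mulNr ler_pdivrMr // mul1r.
by rewrite lerNl; case/andP: (hy e).
Qed.

(** Weak duality on one edge: the cost, as a function of the flow value, is the support function of
    the interval from -wm to wp. *)
Lemma edge_cost_ge (x : 'cV[R]_m) e (u : R) :
  - wm e 0 <= u <= wp e 0 -> x e 0 * u <= edge_cost x e.
Proof.
case/andP=> h1 h2; rewrite /edge_cost.
have h3 : wp e 0 * x e 0 <= Num.max 0 (wp e 0 * x e 0) by rewrite le_max lexx orbT.
have h4 : 0 <= Num.max 0 (wp e 0 * x e 0) by rewrite le_max lexx.
have h5 : - (wm e 0 * x e 0) <= Num.max 0 (- (wm e 0 * x e 0)).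
  by rewrite le_max lexx orbT.
have h6 : 0 <= Num.max 0 (- (wm e 0 * x e 0)) by rewrite le_max lexx.
have [hx|hx] := lerP 0 (x e 0).
  have ? := ler_wpM2l hx h2; lra.
have ? := ler_wnM2l (ltW hx) h1; lra.
Qed.

Lemma asym_weak_duality (x : 'cV[R]_m) (b y : 'cV[R]_n) :
  A *m x = b -> (forall e, - wm e 0 <= (A^T *m y) e 0 <= wp e 0) ->
  dot b y <= asym_cost wp wm x.
Proof.
move=> <- hy; rewrite dot_mulmx asym_costE.
by apply: ler_sum => e _; exact: edge_cost_ge.
Qed.

(** Symmetrising with the smaller weight wm loses at most a factor lam: a forward unit costs wp <=
    lam wm, a backward unit only wm. This is why the oracle is queried with wm. *)
Lemma edge_cost_le_norm (lam : R) (x : 'cV[R]_m) e :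
  1 <= lam -> wp e 0 <= lam * wm e 0 ->
  edge_cost x e <= lam * (wm e 0 * `|x e 0|).
Proof.
move=> hl hw; rewrite /edge_cost; have hwm := wm_gt0 e; have hwp := wp_gt0 e.
have [hx|hx] := ger0P (x e 0).
  have h1 := mulr_ge0 (ltW hwp) hx; have h2 := mulr_ge0 (ltW hwm) hx.
  rewrite max_r // max_l ?oppr_le0 // addr0.
  by have := ler_wpM2r hx hw; rewrite mulrA.
have h1 : wp e 0 * x e 0 < 0 by rewrite pmulr_rlt0.
have h2 : wm e 0 * x e 0 < 0 by rewrite pmulr_rlt0.
rewrite (max_l (ltW h1)) max_r ?oppr_ge0 ?(ltW h2) // add0r.
by have ? := ler_wnM2r (ltW h2) hl; lra.
Qed.

Lemma asym_cost_le_norm (lam : R) (x : 'cV[R]_m) :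
  1 <= lam -> (forall e, wp e 0 <= lam * wm e 0) ->
  asym_cost wp wm x <= lam * \sum_e wm e 0 * `|x e 0|.
Proof.
move=> hl hw; rewrite asym_costE mulr_sumr; apply: ler_sum => e _.
exact: edge_cost_le_norm.
Qed.

(** The added flow is a forward amount a minus a backward amount c. Both may be positive, as they
    are in the gradient flow, and both are charged in full. *)
Lemma edge_cost_add_le (x z f : 'cV[R]_m) (a c : R) e :
  z e 0 = x e 0 + f e 0 -> f e 0 = a - c -> 0 <= a -> 0 <= c ->
  edge_cost z e <= edge_cost x e + (wp e 0 * a + wm e 0 * c).
Proof.
rewrite /edge_cost => -> -> ha hc.
have hwm := wm_gt0 e; have hwp := wp_gt0 e.
have h1 := mulr_ge0 (ltW hwp) ha; have h2 := mulr_ge0 (ltW hwm) hc.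
have h3 := mulr_ge0 (ltW hwm) ha; have h4 := mulr_ge0 (ltW hwp) hc.
have k1 : wp e 0 * x e 0 <= Num.max 0 (wp e 0 * x e 0) by rewrite le_max lexx orbT.
have k2 : 0 <= Num.max 0 (wp e 0 * x e 0) by rewrite le_max lexx.
have k3 : - (wm e 0 * x e 0) <= Num.max 0 (- (wm e 0 * x e 0)).
  by rewrite le_max lexx orbT.
have k4 : 0 <= Num.max 0 (- (wm e 0 * x e 0)) by rewrite le_max lexx.
have l1 : Num.max 0 (wp e 0 * (x e 0 + (a - c)))
    <= Num.max 0 (wp e 0 * x e 0) + wp e 0 * a.
  by rewrite ge_max; apply/andP; split; lra.
have l2 : Num.max 0 (- (wm e 0 * (x e 0 + (a - c))))
    <= Num.max 0 (- (wm e 0 * x e 0)) + wm e 0 * c.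
  by rewrite ge_max; apply/andP; split; lra.
lra.
Qed.

(** * The potential, its gradient flow and the dual gauge *)

Section Potential.
Variable eta : R.
Hypothesis eta_ge0 : 0 <= eta.
Implicit Types u v : 'cV[R]_m.

(** Up to a factor eta, [wexp_p] and [- wexp_m] are the derivatives in [u e 0] of the two
    exponential terms of edge e in the potential. *)
Definition wexp_p u e : R := expR (eta * u e 0 / wp e 0) / (wp e 0 + wm e 0).
Definition wexp_m u e : R := expR (- (eta * u e 0 / wm e 0)) / (wp e 0 + wm e 0).

(* The weights wp/(wp+wm) and wm/(wp+wm) make u = 0 the global minimum. *)
Definition potential u : R :=
  \sum_e (wp e 0 * wexp_p u e + wm e 0 * wexp_m u e).

(** The gradient of ln Z divided by eta. Charging its forward parts wp and its backward parts wm
    gives Z / Z = 1, which bounds its cost. *)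
Definition grad_flow u : 'cV[R]_m :=
  \col_e ((wexp_p u e - wexp_m u e) / potential u).

Let w_gt0 e : 0 < wp e 0 + wm e 0. Proof. exact: addr_gt0. Qed.

Lemma wexp_p_ge0 u e : 0 <= wexp_p u e.
Proof. by rewrite divr_ge0 ?expR_ge0 ?ltW. Qed.

Lemma wexp_m_ge0 u e : 0 <= wexp_m u e.
Proof. by rewrite divr_ge0 ?expR_ge0 ?ltW. Qed.

(** With [1 + z <= expR z] on both exponentials, the linear terms eta u and -eta u cancel. *)
Lemma potential_term_ge1 u e :
  1 <= wp e 0 * wexp_p u e + wm e 0 * wexp_m u e.
Proof.
have h1 := expR_ge1Dx (eta * u e 0 / wp e 0).
have h2 := expR_ge1Dx (- (eta * u e 0 / wm e 0)).
have h3 := ler_wpM2l (ltW (wp_gt0 e)) h1.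
have h4 := ler_wpM2l (ltW (wm_gt0 e)) h2.
rewrite /wexp_p /wexp_m !mulrA -mulrDl ler_pdivlMr // mul1r.
apply: le_trans (lerD h3 h4); rewrite !mulrDr !mulr1 mulrN.
rewrite ![_ * (eta * _ / _)]mulrC !divfK ?gt_eqF //; lra.
Qed.

Lemma potential_ge u : m%:R <= potential u.
Proof.
rewrite -[m in m%:R]card_ord -sum1_card natr_sum.
by apply: ler_sum => e _; exact: potential_term_ge1.
Qed.

Lemma potential0 : potential 0 = m%:R.
Proof.
rewrite -[m in m%:R]card_ord -sum1_card natr_sum; apply: eq_bigr => e _.
rewrite /wexp_p /wexp_m mxE mulr0 !mul0r oppr0 expR0 -mulrDl mul1r divff //.
by rewrite gt_eqF.
Qed.

Lemma potential_gt0 u : (0 < m)%N -> 0 < potential u.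
Proof. by move=> hm; apply: lt_le_trans (potential_ge u); rewrite ltr0n. Qed.

(** Both ratios v/wp and v/wm lie in [-1, 1], so each exponential grows by at most 1 + 2 eta^2 plus
    its linear term; the linear terms sum to eta Z times the pairing of the gradient flow with v. *)
Lemma potential_step u v :
  (0 < m)%N -> eta <= 1 / 2 -> (forall e, `|v e 0| <= wm e 0) ->
  potential (u + v)
    <= potential u * expR (2 * eta ^+ 2 + eta * dot (grad_flow u) v).
Proof.
move=> hm heta hv; have hZ := potential_gt0 u hm.
have step_exp (t : R) : `|t| <= 1 ->
    expR (eta * t) <= 1 + 2 * eta ^+ 2 + eta * t.
  move=> ht; have [ht1 ht2] : -1 <= t /\ t <= 1 by move: ht; rewrite ler_norml => /andP.
  have := ler_wpM2l eta_ge0 ht2; rewrite mulr1 => het.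
  apply: (le_trans (expR_le_quadratic _)); first by lra.
  have : (eta * t) ^+ 2 <= eta ^+ 2.
    rewrite exprMn -[leRHS]mulr1 ler_wpM2l ?sqr_ge0 //.
    by rewrite -real_normK ?num_real // expr_le1.
  move=> ?; lra.
have le1p e : `|v e 0 / wp e 0| <= 1.
  rewrite normf_div (gtr0_norm (wp_gt0 e)) ler_pdivrMr // mul1r.
  exact: le_trans (hv e) (wm_le_wp e).
have le1m e : `|- (v e 0 / wm e 0)| <= 1.
  by rewrite normrN normf_div (gtr0_norm (wm_gt0 e)) ler_pdivrMr // mul1r.
have ep e : wexp_p (u + v) e = wexp_p u e * expR (eta * (v e 0 / wp e 0)).
  by rewrite /wexp_p mxE mulrDr mulrDl expRD !mulrA mulrAC.
have em e : wexp_m (u + v) e = wexp_m u e * expR (eta * - (v e 0 / wm e 0)).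
  rewrite /wexp_m mxE mulrDr mulrDl opprD expRD mulrN !mulrA.
  by rewrite [LHS]mulrAC.
have -> : potential u * expR (2 * eta ^+ 2 + eta * dot (grad_flow u) v)
  = expR (2 * eta ^+ 2 + eta * dot (grad_flow u) v) * potential u.
  by rewrite mulrC.
(* It suffices to prove the bound with the exponential replaced by its tangent at 0, which can be
   compared edge by edge. *)
apply: le_trans (ler_wpM2r (ltW hZ) (expR_ge1Dx _)).
have hdot : dot (grad_flow u) v * potential u
    = \sum_e (wexp_p u e - wexp_m u e) * v e 0.
  rewrite /dot mulr_suml; apply: eq_bigr => e _.
  by rewrite mxE mulrAC divfK // gt_eqF.
have -> : (1 + (2 * eta ^+ 2 + eta * dot (grad_flow u) v)) * potential u
  = (1 + 2 * eta ^+ 2) * potential u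
    + eta * (dot (grad_flow u) v * potential u) by ring.
rewrite hdot /potential !mulr_sumr -big_split /=; apply: ler_sum => e _.
rewrite ep em.
have hp := mulr_ge0 (ltW (wp_gt0 e)) (wexp_p_ge0 u e).
have hn := mulr_ge0 (ltW (wm_gt0 e)) (wexp_m_ge0 u e).
have i1 := ler_wpM2l hp (step_exp _ (le1p e)).
have i2 := ler_wpM2l hn (step_exp _ (le1m e)).
rewrite [_ * (_ * expR _)]mulrA [wm e 0 * (_ * expR _)]mulrA.
apply: (le_trans (lerD i1 i2)); rewrite le_eqVlt; apply/orP; left; apply/eqP.
by field; rewrite !gt_eqF.
Qed.

(** This is q(R_* u), the least q >= 0 with -q wm <= u <= q wp, written as two maxima because the
    program computes it with two [EMax] instructions. *)
Definition dual_gauge u : R :=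
  Num.max (\big[Num.max/0]_e (u e 0 / wp e 0))
          (\big[Num.max/0]_e (- (u e 0 / wm e 0))).

Lemma dual_gauge_ge0 u : 0 <= dual_gauge u.
Proof. by rewrite le_max bigmax_ge_id. Qed.

Lemma dual_gauge_bounds u e :
  - (dual_gauge u * wm e 0) <= u e 0 <= dual_gauge u * wp e 0.
Proof.
apply/andP; split.
  rewrite lerNl -ler_pdivrMr // mulNr /dual_gauge le_max.
  by apply/orP; right; apply: (le_bigmax _ (fun e => - (u e 0 / wm e 0))).
rewrite -ler_pdivrMr // /dual_gauge le_max.
by apply/orP; left; apply: (le_bigmax _ (fun e => u e 0 / wp e 0)).
Qed.

(** The ratio attaining the gauge occurs in an exponential whose coefficient is at least wm/(wp +
    wm) >= 1/(1 + lam). *)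
Lemma potential_ge_gauge (lam : R) u :
  (0 < m)%N -> 1 <= lam -> (forall e, wp e 0 <= lam * wm e 0) ->
  expR (eta * dual_gauge u) <= (1 + lam) * potential u.
Proof.
move=> hm hl hw; have hl0 : 0 <= 1 + lam by lra.
(* [K] holds at 0 and is preserved by maxima, so it only has to be checked on single ratios. *)
pose K (q : R) := expR (eta * q) <= (1 + lam) * potential u.
have K0 : K 0.
  rewrite /K mulr0 expR0; have h1 : 1 <= potential u.
    by apply: le_trans (potential_ge u); rewrite ler1n.
  by apply: (le_trans h1); rewrite ler_peMl //; lra.
have Kmax x y : K x -> K y -> K (Num.max x y) by move=> hx hy; case: (leP x y).
have term e : wp e 0 * wexp_p u e + wm e 0 * wexp_m u e <= potential u.
  rewrite /potential (bigD1 e) //= lerDl; apply: sumr_ge0 => i _.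
  exact: addr_ge0 (mulr_ge0 (ltW (wp_gt0 i)) (wexp_p_ge0 u i))
                  (mulr_ge0 (ltW (wm_gt0 i)) (wexp_m_ge0 u i)).
have Ke e (z : R) : 0 <= z ->
    z / (wp e 0 + wm e 0) * wm e 0 <= potential u -> z <= (1 + lam) * potential u.
  move=> hz h; apply: le_trans (ler_wpM2l hl0 h).
  have -> : (1 + lam) * (z / (wp e 0 + wm e 0) * wm e 0)
    = z * ((1 + lam) * wm e 0 / (wp e 0 + wm e 0)) by ring.
  have ? := hw e; rewrite ler_peMr // ler_pdivlMr // mul1r; lra.
have Kp e : K (u e 0 / wp e 0).
  rewrite /K mulrA; apply: (Ke e); first exact: expR_ge0.
  apply: le_trans (term e); rewrite -/(wexp_p u e).
  have h1 := mulr_ge0 (ltW (wm_gt0 e)) (wexp_m_ge0 u e).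
  by have ? := ler_wpM2r (wexp_p_ge0 u e) (wm_le_wp e); lra.
have Km e : K (- (u e 0 / wm e 0)).
  rewrite /K mulrN mulrA; apply: (Ke e); first exact: expR_ge0.
  apply: le_trans (term e); rewrite -/(wexp_m u e).
  by have ? := mulr_ge0 (ltW (wp_gt0 e)) (wexp_p_ge0 u e); lra.
by apply: (Kmax); apply: (big_ind K).
Qed.

(** Apply [edge_cost_add_le] with a and c equal to s/Z times [wexp_p] and [wexp_m]; the charges sum
    to (s/Z) Z = s. *)
Lemma asym_cost_add_flow (x u : 'cV[R]_m) (s : R) :
  (0 < m)%N -> 0 <= s ->
  asym_cost wp wm (x + s *: grad_flow u) <= asym_cost wp wm x + s.
Proof.
move=> hm hs; have hZ := potential_gt0 u hm.
have hsZ : 0 <= s / potential u by exact: divr_ge0 hs (ltW hZ).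
have -> : asym_cost wp wm x + s
  = \sum_e (edge_cost x e + (wp e 0 * (s / potential u * wexp_p u e)
                           + wm e 0 * (s / potential u * wexp_m u e))).
  rewrite big_split /= -asym_costE; congr (_ + _).
  transitivity (s / potential u * potential u); first by rewrite divfK ?gt_eqF.
  by rewrite {2}/potential mulr_sumr; apply: eq_bigr => e _; ring.
rewrite asym_costE; apply: ler_sum => e _.
apply: (edge_cost_add_le (f := s *: grad_flow u)).
- by rewrite mxE.
- by rewrite !mxE; ring.
- by rewrite mulr_ge0 ?wexp_p_ge0.
- by rewrite mulr_ge0 ?wexp_m_ge0.
Qed.

End Potential.
End Asymmetric.

(** * The loop invariant and the number of iterations *)

Lemma le_pow1D (R : realType) (e : R) (k : nat) :
  0 <= e -> k%:R * e <= (1 + e) ^+ k.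
Proof.
move=> he; suff : 1 + k%:R * e <= (1 + e) ^+ k by move=> ?; lra.
elim: k => [|k IH]; first by rewrite mul0r addr0.
have h1 : 0 <= 1 + e by lra.
rewrite exprS; apply: le_trans (ler_wpM2l h1 IH).
have h2 : 0 <= k%:R * e * e by rewrite !mulr_ge0.
rewrite -natr1; lra.
Qed.

Section Iteration.
Variables (R : realType) (n m : nat) (A : 'M[R]_(n, m)).
Variables (wp wm : 'cV[R]_m) (b : 'cV[R]_n).
Variables (alpha lam e eta s0 : R) (y0 : 'cV[R]_n).
Hypothesis m_gt0 : (0 < m)%N.
Hypothesis wm_gt0 : forall i, 0 < wm i 0.
Hypothesis wm_le_wp : forall i, wm i 0 <= wp i 0.
Hypothesis alpha_ge1 : 1 <= alpha.
Hypothesis lam_ge1 : 1 <= lam.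
Hypothesis wp_le_lam : forall i, wp i 0 <= lam * wm i 0.
Hypothesis e_gt0 : 0 < e.
Hypothesis e_le1 : e <= 1.
Hypothesis etaE : eta = e / (4 * (alpha * lam)).
Hypothesis y0_bounds : forall i, `|(A^T *m y0) i 0| <= wm i 0.
Hypothesis s0_le : s0 <= lam * alpha * dot b y0.

Let params : [/\ 1 <= alpha, 1 <= lam, 0 < e & e <= 1].
Proof. by []. Qed.

Let al_gt0 : 0 < alpha * lam.
Proof. have [? ? _ _] := params; by apply: mulr_gt0; lra. Qed.

Let eta_gt0 : 0 < eta.
Proof. by rewrite etaE divr_gt0 // mulr_gt0. Qed.

Let eta_le : eta <= 1 / 2.
Proof.
have [a1 l1 e0 e1] := params.
have h : 1 <= alpha * lam by rewrite -[1]mulr1 ler_pM.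
by rewrite etaE ler_pdivrMr ?mulr_gt0 //; lra.
Qed.

(* k1 counts the steps that update Y, k2 those that lower the guess s. *)
Record loop_inv (k1 k2 : nat) (s : R) (Y : 'cV[R]_n) (x : 'cV[R]_m) : Prop :=
  LoopInv {
    inv_s_gt0 : 0 < s;
    inv_s : s * (1 + e) ^+ k2 = s0;
    inv_feasible : A *m x = b;
    inv_cost : asym_cost wp wm x <= (1 + e) ^+ 2 * s;
    inv_potential : potential wp wm eta (A^T *m Y)
      <= m%:R * expR (eta * (dot b Y / s) - 2 * eta ^+ 2 * k1%:R)
  }.

Let flow Y := grad_flow wp wm eta (A^T *m Y).

(** A costly [x'] forces the residual demand to pair with [y'] to more than e s / (alpha lam).
    Divided by s this is a gain of 4 eta, so the exponent wins 4 eta^2, of which the second-order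
    error in [potential_step] takes back 2 eta^2. *)
Lemma inv_dual_step k1 k2 s Y x x' y' :
  loop_inv k1 k2 s Y x ->
  sym_approx A alpha wm (b - A *m (s *: flow Y)) x' y' ->
  e * s < lam * \sum_i wm i 0 * `|x' i 0| ->
  loop_inv k1.+1 k2 s (Y + y') x.
Proof.
have [a1 l1 e0 e1] := params.
case=> hs hs0 hx hc hpot [_ hy' hxy] hlt; split=> //.
have al0 : 0 < alpha by lra.
have lam0 : 0 < lam by lra.
have hgain : eta * dot (flow Y) (A^T *m y')
    <= eta * (dot b y' / s) - 4 * eta ^+ 2.
  have h1 : dot (b - A *m (s *: flow Y)) y'
      = dot b y' - s * dot (flow Y) (A^T *m y').
    rewrite -dot_mulmx /dot mulr_sumr -sumrB; apply: eq_bigr => i _.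
    by rewrite -scalemxAr !mxE mulrBl mulrA.
  rewrite norm1_diagw // h1 in hxy.
  have h2 := ler_wpM2l (ltW lam0) hxy.
  have h3 : e * s <= alpha * lam * (dot b y' - s * dot (flow Y) (A^T *m y')).
    by apply: (le_trans (ltW hlt)); apply: (le_trans h2); rewrite mulrA (mulrC lam).
  have h4 : e / (alpha * lam) <= dot b y' / s - dot (flow Y) (A^T *m y').
    rewrite ler_pdivrMr // -(ler_pM2r hs) mulrAC mulrBl divfK ?gt_eqF //.
    by apply: (le_trans h3); rewrite mulrC (mulrC s).
  have h5 : 4 * eta = e / (alpha * lam).
    by rewrite etaE; field; rewrite !gt_eqF.
  by rewrite -h5 in h4; have := ler_wpM2l (ltW eta_gt0) h4 => h6; lra.
have hv := sym_dual_feasible_edge wm_gt0 hy'.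
have := potential_step wm_gt0 wm_le_wp (ltW eta_gt0) (A^T *m Y) m_gt0 eta_le hv.
rewrite -mulmxDr => hstep; apply: (le_trans hstep).
apply: (le_trans (ler_wpM2r (expR_ge0 _) hpot)).
rewrite /= -[m%:R * expR _ * _]mulrA -expRD ler_pM2l ?ltr0n // ler_expR.
rewrite dotDr -natr1 -/(flow Y).
lra.
Qed.

(** The potential is at least m, so the exponent in the invariant is nonnegative. *)
Lemma inv_dot_ge0 k1 k2 s Y x : loop_inv k1 k2 s Y x -> 0 <= dot b Y.
Proof.
have [a1 l1 e0 e1] := params.
case=> hs _ _ _ hpot.
have h := le_trans (potential_ge wm_gt0 wm_le_wp eta _) hpot.
rewrite -[leLHS]mulr1 ler_pM2l ?ltr0n // -[leLHS]expR0 ler_expR in h.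
have h2 : 0 <= 2 * eta ^+ 2 * k1%:R.
  by rewrite mulr_ge0 // mulr_ge0 // sqr_ge0.
have h3 : 0 <= eta * (dot b Y / s) by lra.
by move: h3; rewrite pmulr_rge0 // pmulr_lge0 // invr_gt0.
Qed.

Lemma inv_primal_step k1 k2 s Y x x' y' :
  loop_inv k1 k2 s Y x ->
  sym_approx A alpha wm (b - A *m (s *: flow Y)) x' y' ->
  lam * (\sum_i wm i 0 * `|x' i 0|) <= e * s ->
  loop_inv k1 k2.+1 (s / (1 + e)) Y (x' + s *: flow Y).
Proof.
have [a1 l1 e0 e1] := params.
move=> hinv; have hdot := inv_dot_ge0 hinv.
case: hinv => hs hs0 hx hc hpot [hx' _ _] hle.
have he1 : 0 < 1 + e by lra.
split.
- exact: divr_gt0.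
- by rewrite exprS mulrA divfK ?gt_eqF.
- by rewrite mulmxDr hx' subrK.
(* The new flow costs at most e s + s; the second factor 1 + e in the invariant pays for the lowered
   guess. *)
- have h1 := asym_cost_add_flow wm_gt0 wm_le_wp eta x' (A^T *m Y) m_gt0 (ltW hs).
  have h2 := asym_cost_le_norm wm_gt0 wm_le_wp x' lam_ge1 wp_le_lam.
  have -> : (1 + e) ^+ 2 * (s / (1 + e)) = (1 + e) * s.
    by field; rewrite gt_eqF.
  by rewrite /flow; lra.
(* As b.Y >= 0, lowering s only enlarges the exponent. *)
- apply: (le_trans hpot); rewrite ler_pM2l ?ltr0n // ler_expR lerD2r.
  rewrite ler_pM2l // ler_wpM2l // lef_pV2 ?posrE ?divr_gt0 //.
  by rewrite ler_pdivrMr //; have ? := mulr_gt0 hs e_gt0; lra.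
Qed.

(** The first term is (lam + ln m)/(2 eta^2) and bounds k1; the second bounds k2. *)
Definition iteration_bound : R :=
  8 * (alpha * lam) ^+ 2 * (lam + ln m%:R) / e ^+ 2 + 4 * (alpha * lam) / e.

Lemma inv_bound k1 k2 s Y x :
  loop_inv k1 k2 s Y x ->
  dot b Y <= s * dual_gauge wp wm (A^T *m Y) ->
  (k1 + k2)%:R <= iteration_bound.
Proof.
have [a1 l1 e0 e1] := params.
case=> hs hs0 hx hc hpot htest; rewrite natrD; apply: lerD.
  have h1 := potential_ge_gauge wm_gt0 wm_le_wp eta (A^T *m Y) m_gt0 lam_ge1 wp_le_lam.
  have l0 : 0 < 1 + lam by lra.
  have h2 := le_trans h1 (ler_wpM2l (ltW l0) hpot).
  (* Using lam in place of ln (1 + lam) is crude, but lam^2 times lam still fits under lam^4. *)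
  have h3 : 1 + lam <= expR lam by exact: expR_ge1Dx.
  have m0 : 0 < m%:R :> R by rewrite ltr0n.
  have h4 : expR (eta * dual_gauge wp wm (A^T *m Y))
     <= expR (lam + ln m%:R + (eta * (dot b Y / s) - 2 * eta ^+ 2 * k1%:R)).
    apply: (le_trans h2); rewrite [leLHS]mulrA [leRHS]expRD [expR (lam + _)]expRD lnK ?posrE //.
    by rewrite ler_wpM2r ?expR_ge0 // ler_wpM2r // ltW.
  rewrite ler_expR in h4.
  have h5 : dot b Y / s <= dual_gauge wp wm (A^T *m Y).
    by rewrite ler_pdivrMr // mulrC.
  have h6 := ler_wpM2l (ltW eta_gt0) h5.
  have h7 : k1%:R * (2 * eta ^+ 2) <= lam + ln m%:R by lra.
  have -> : 8 * (alpha * lam) ^+ 2 * (lam + ln m%:R) / e ^+ 2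
      = (lam + ln m%:R) / (2 * eta ^+ 2).
    by rewrite etaE; field; rewrite !gt_eqF //; lra.
  by rewrite ler_pdivlMr // mulr_gt0 // exprn_gt0.
(* The first dual answer is feasible for the asymmetric problem because wm <= wp, so it bounds every
   later flow cost from below. Hence (1 + e)^k2 <= 4 alpha lam. *)
have hwd : dot b y0 <= asym_cost wp wm x.
  apply: (asym_weak_duality (A := A)) => // i.
  move: (y0_bounds i); rewrite ler_norml => /andP[-> h] /=.
  exact: le_trans h (wm_le_wp i).
have h1 : s0 <= lam * alpha * ((1 + e) ^+ 2 * s).
  apply: (le_trans s0_le); rewrite ler_pM2l; first exact: le_trans hwd hc.
  by rewrite mulrC.
have rhsE : lam * alpha * ((1 + e) ^+ 2 * s) = s * (alpha * lam * (1 + e) ^+ 2).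
  by ring.
rewrite -hs0 rhsE ler_pM2l // in h1.
have h2 := le_pow1D k2 (ltW e_gt0).
have h3 : (1 + e) ^+ 2 <= 4.
  have : e ^+ 2 <= 1 by rewrite expr_le1 // ltW.
  by rewrite sqrrD expr1n => ?; lra.
have h4 := ler_wpM2l (ltW al_gt0) h3.
by rewrite ler_pdivlMr //; lra.
Qed.

Lemma inv_exit k1 k2 s Y x :
  loop_inv k1 k2 s Y x ->
  s * dual_gauge wp wm (A^T *m Y) < dot b Y ->
  let y := (dual_gauge wp wm (A^T *m Y))^-1 *: Y in
  asym_dual_feasible A wp wm y /\
  asym_cost wp wm x <= (1 + 3 * e) * dot b y.
Proof.
have [e0 e1] : 0 < e /\ e <= 1 by [].
case=> hs hs0 hx hc hpot htest /=; set q := dual_gauge _ _ _ in htest *.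
have hb := dual_gauge_bounds wm_gt0 wm_le_wp (A^T *m Y); rewrite -/q in hb.
have q_ge0 : 0 <= q by exact: dual_gauge_ge0.
(* If q = 0, then A^T Y = 0 and b.Y = x.(A^T Y) = 0, against the strict exit test. *)
have q_gt0 : 0 < q.
  rewrite lt_neqAle q_ge0 andbT; apply/eqP => q0.
  have : dot b Y = 0.
    rewrite -hx dot_mulmx /dot big1 // => i _.
    have := hb i; rewrite -q0 !mul0r oppr0 -eq_le => /eqP <-.
    by rewrite mulr0.
  by move=> h; rewrite h -q0 mulr0 ltxx in htest.
split.
  apply: (asym_dual_feasibleP wm_gt0 wm_le_wp) => i.
  rewrite -scalemxAr mxE; case/andP: (hb i) => h1 h2.
  by rewrite -ler_pdivrMl ?invr_gt0 // invrK mulrN h1 ler_pdivrMl.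
rewrite dotZr.
have h1 : s <= q^-1 * dot b Y by rewrite mulrC ler_pdivlMr // ltW.
apply: (le_trans hc).
have h2 : (1 + e) ^+ 2 <= 1 + 3 * e.
  have : e ^+ 2 <= e by rewrite expr2 ler_piMl // ltW.
  by rewrite sqrrD expr1n => ?; lra.
by apply: ler_pM => //; rewrite ?exprn_ge0 ?ltW //; lra.
Qed.
End Iteration.

(** * Execution of straight-line code and bounded loops, and the program itself *)

Definition block (l : seq instr) (P : prog) : prog :=
  foldr (fun c Q => Seq (Instr c) Q) P l.

Definition run (R : realType) (n m : nat) (A : 'M[R]_(n, m)) (l : seq instr)
    (st : state R n m) : state R n m :=
  foldl (fun st' c => step A c st') st l.

Lemma exec_block (R : realType) (n m : nat) (A : 'M[R]_(n, m))
    (O : oracle_type R n m) l P st st' k t :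
  exec A O P (run A l st) st' k t ->
  exec A O (block l P) st st' k (size l + t).
Proof.
elim: l st => [|c l IH] st //= h; rewrite -[k]add0n.
exact: exec_seq (exec_instr A O c st) (IH _ h).
Qed.

Lemma exec_instrs (R : realType) (n m : nat) (A : 'M[R]_(n, m))
    (O : oracle_type R n m) l c st :
  exec A O (block l (Instr c)) st (run A (rcons l c) st) 0 (size l + 1).
Proof.
by apply: exec_block; rewrite /run -cats1 foldl_cat; apply: exec_instr.
Qed.

(** The bound on k is available only when the test succeeds, so the last round starts at k <= B and
    N is at most 1 + B. Each round costs c operations and one test; the final 1 is the failing
    test. *)
Lemma exec_while_bounded (R : realType) (n m : nat) (A : 'M[R]_(n, m))
    (O : oracle_type R n m) i j P c (B : R)
    (I : nat -> state R n m -> Prop) :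
  (forall k st, I k st -> sreg st i <= sreg st j ->
     k%:R <= B /\ exists st', exec A O P st st' 1 c /\ I k.+1 st') ->
  forall st, I 0%N st ->
  exists st' k N, [/\ exec A O (While i j P) st st' N (N * c.+1 + 1),
    I k st', sreg st' j < sreg st' i & N%:R <= 1 + Num.max 0 B].
Proof.
move=> hstep st hI.
(* No round can start at index [K] or later, so the induction runs on the distance d to [K]. *)
have [K hK] : exists K : nat, B < K%:R.
  by exists (Num.truncn `|B|).+1; rewrite (le_lt_trans (ler_norm B)) // truncnS_gt.
suff H d : forall k st, (K <= k + d)%N -> I k st ->
    exists st' k' N, [/\ exec A O (While i j P) st st' N (N * c.+1 + 1),
    I k' st', sreg st' j < sreg st' i, k' = (k + N)%N &
    (0 < N)%N -> (k + N)%:R <= 1 + B].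
  have [st' [k [N [h1 h2 h3 h4 h5]]]] := H K 0%N st (leqnn _) hI.
  exists st', k, N; split=> //; case: N h5 {h1 h4} => [|N] h5.
    by rewrite addr_ge0 // le_max lexx.
  by apply: (le_trans (h5 isT)); rewrite lerD2l le_max lexx orbT.
(* In both cases a failed test ends the loop with N = 0. *)
elim: d => [|d IH] k {hI}st hd hI;
    (case: (leP (sreg st i) (sreg st j)) => ht; last first;
      [by exists st, k, 0%N; split; rewrite ?addn0 //; exact: exec_while_false|]);
    have [hB [st1 [he hI1]]] := hstep _ _ hI ht.
  rewrite addn0 in hd.
  by have := le_lt_trans hB hK; rewrite ltr_nat ltnNge hd.
have [||st' [k' [N [h1 h2 h3 h4 h5]]]] := IH k.+1 st1 => //; first by rewrite addSnnS.
exists st', k', N.+1; split=> //.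
- have -> : (N.+1 * c.+1 + 1 = (c + (N * c.+1 + 1)).+1)%N.
    by rewrite mulSn addSn addnA.
  by rewrite -[N.+1]add1n; exact: exec_while_true ht he h1.
- by rewrite h4 addSnnS.
- move=> _; rewrite -addSnnS; case: N h5 {h1 h4} => [|N] h5; last exact: h5.
  by rewrite addn0 -natr1 addrC lerD2l.
Qed.

(* Scalar registers: 2 = e, 3 = lam, 4 = eta, 5 = s, 6 = b.Y, 7 = s q(Y),
   13 = 1 + e, 15 = q(Y).  Node registers: 0 = b, 1 = Y.  Edge registers: 0 = wp,
   1 = wm, 2 = best flow, 3 = A^T Y.  Scalar register 14 and edge register 20 are
   never written and hold 0; copying is done by taking the max of a register
   with itself. *)
Definition init_code : seq instr :=
  [:: SConst 9 1; SConst 11 3; SBin Div 2 0 11;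
      EBin Div 4 0 1; EMax 3 4; SBin Max 3 3 9;
      SBin Mul 12 1 3; SConst 11 4; SBin Mul 12 11 12; SBin Div 4 2 12;
      SBin Add 13 9 2].

Definition cost_code : seq instr :=
  [:: EBin Mul 4 0 2; EBin Max 4 20 4; EBin Mul 5 1 2; EBin Defs.Sub 5 20 5;
      EBin Max 5 20 5; EBin Add 4 4 5].

Definition init_prog : prog :=
  block init_code
    (Seq (Call 1 0 2 3) (block cost_code (Instr (ESum 5 4)))).

Definition flow_code : seq instr :=
  [:: EFill 6 4; EBin Mul 7 6 3; EBin Div 8 7 0; EUn Exp 8 8;
      EBin Div 9 7 1; EBin Defs.Sub 9 20 9; EUn Exp 9 9;
      EBin Add 10 0 1; EBin Div 8 8 10; EBin Div 9 9 10;
      EBin Mul 11 0 8; EBin Mul 12 1 9; EBin Add 11 11 12; ESum 8 11;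
      EBin Defs.Sub 8 8 9; EFill 9 8; EBin Div 8 8 9;
      EFill 9 5; EBin Mul 8 9 8].

Definition demand_code : seq instr := [:: MulA 2 8; NBin Defs.Sub 2 0 2].

(** The absolute value is the maximum of x' and -x'. Scalar registers 8 and 11 receive lam times the
    wm-norm and e s, the two sides of the test in [branch]. *)
Definition norm_code : seq instr :=
  [:: EBin Defs.Sub 5 20 4; EBin Max 5 4 5; EBin Mul 5 1 5; ESum 8 5;
      SBin Mul 8 3 8; SBin Mul 11 2 5].

Definition gauge_code : seq instr :=
  [:: EBin Div 5 3 0; EMax 8 5; EBin Div 5 3 1; EBin Defs.Sub 5 20 5; EMax 11 5;
      SBin Max 15 8 11; SBin Mul 7 5 15; NBin Mul 2 0 1].

(** A cheap oracle flow gives the primal step, with x' + s f as new best flow; otherwise y' is added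
    to Y and A^T Y recomputed. *)
Definition branch : prog :=
  If 8 11 (block [:: EBin Add 2 4 8] (Instr (SBin Div 5 5 13)))
          (block [:: NBin Add 1 1 3] (Instr (MulAT 3 1))).

Definition loop_body : prog :=
  Seq (block flow_code (block demand_code (Call 1 2 4 3)))
    (block norm_code (Seq branch (block gauge_code (Instr (NSum 6 2))))).

Definition final_prog : prog :=
  block [:: EBin Max 0 2 2; NFill 2 15] (Instr (NBin Div 0 1 2)).

(** The case s <= 0 is answered at once by the first oracle pair, which keeps divisions by s safe in
    the loop. *)
Definition transshipment_prog : prog :=
  Seq init_prog
    (If 5 14 (block [:: EBin Max 0 2 2] (Instr (NBin Max 0 3 3)))
             (Seq (While 6 7 loop_body) final_prog)).

(** * Effect of each piece of code on the registers *)

Section Simulation.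
Variables (R : realType) (n m : nat) (A : 'M[R]_(n, m)) (O : oracle_type R n m).
Variables (wp wm : 'cV[R]_m) (b : 'cV[R]_n) (lam e eta : R).
Implicit Types (st : state R n m) (s : R) (Y y : 'cV[R]_n) (x f : 'cV[R]_m).

(** What a loop round relies on and restores; the scratch registers are left free. *)
Record core st s Y x : Prop := Core {
  core_e : sreg st 2 = e;
  core_lam : sreg st 3 = lam;
  core_eta : sreg st 4 = eta;
  core_s : sreg st 5 = s;
  core_1e : sreg st 13 = 1 + e;
  core_b : nreg st 0%N = b;
  core_Y : nreg st 1%N = Y;
  core_wp : ereg st 0%N = wp;
  core_wm : ereg st 1%N = wm;
  core_x : ereg st 2 = x;
  core_u : ereg st 3 = A^T *m Y;
  core_0 : ereg st 20 = 0
}.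

(** Symbolic evaluation, by conversion alone; the contents given by [core] are substituted
    afterwards. *)
Lemma run_flow_code_flow st :
  ereg (run A flow_code st) 8 =
  let div (a c : 'cV[R]_m) := map2_mx (eval_bin Div) a c in
  let mul (a c : 'cV[R]_m) := map2_mx (eval_bin Mul) a c in
  let sub (a c : 'cV[R]_m) := map2_mx (eval_bin Defs.Sub) a c in
  let add (a c : 'cV[R]_m) := map2_mx (eval_bin Add) a c in
  let u := mul (const_mx (sreg st 4)) (ereg st 3) in
  let w := add (ereg st 0%N) (ereg st 1%N) in
  let p := div (map_mx (eval_un Exp) (div u (ereg st 0%N))) w in
  let q := div (map_mx (eval_un Exp)
                  (sub (ereg st 20) (div u (ereg st 1%N)))) w in
  let Z := \sum_i add (mul (ereg st 0%N) p) (mul (ereg st 1%N) q) i 0 in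
  mul (const_mx (sreg st 5)) (div (sub p q) (const_mx Z)).
Proof. by []. Qed.

Lemma run_flow_code st s Y x :
  core st s Y x ->
  let f := s *: grad_flow wp wm eta (A^T *m Y) in
  let st' := run A flow_code st in
  core st' s Y x /\ ereg st' 8 = f.
Proof.
move=> hcore f st'.
have hf : ereg st' 8 = f.
  rewrite /st' run_flow_code_flow; case: hcore => _ _ -> -> _ _ _ -> -> _ -> ->.
  rewrite {}/f; move: (A^T *m Y) => u; cbv zeta.
  apply/matrixP => i j; rewrite ord1; do 2 rewrite ?mxE /=.
  congr (_ * (_ / _)); first by do 6 rewrite ?mxE /=; rewrite sub0r.
  by rewrite ?mxE; apply: eq_bigr => k _; do 6 rewrite ?mxE /=; rewrite sub0r.
by split=> //; case: hcore => *; split.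
Qed.

Lemma run_demand_code st s Y x :
  core st s Y x ->
  let st' := run A demand_code st in
  [/\ core st' s Y x, ereg st' 8 = ereg st 8 & nreg st' 2 = b - A *m ereg st 8].
Proof.
move=> hcore st'; split=> //; first by case: hcore => *; split.
have -> : nreg st' 2 = map2_mx (eval_bin Defs.Sub) (nreg st 0%N) (A *m ereg st 8).
  by [].
by rewrite (core_b hcore); apply/matrixP => i j; rewrite !mxE.
Qed.

Lemma run_norm_code st s Y x :
  core st s Y x ->
  let st' := run A norm_code st in
  [/\ core st' s Y x, sreg st' 8 = lam * \sum_i wm i 0 * `|ereg st 4 i 0|,
      sreg st' 11 = e * s &
      [/\ ereg st' 4 = ereg st 4, ereg st' 8 = ereg st 8 & nreg st' 3 = nreg st 3]].
Proof.
move=> hcore st'; split=> //.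
- by case: hcore => *; split.
- have -> : sreg st' 8 = sreg st 3 * \sum_i map2_mx *%R (ereg st 1%N)
      (map2_mx Num.max (ereg st 4) (map2_mx (eval_bin Defs.Sub) (ereg st 20) (ereg st 4))) i 0.
    by [].
  rewrite (core_lam hcore) (core_wm hcore) (core_0 hcore); congr (_ * _).
  by apply: eq_bigr => i _; rewrite !mxE /= sub0r maxrN.
- have -> : sreg st' 11 = sreg st 2 * sreg st 5 by [].
  by rewrite (core_e hcore) (core_s hcore).
Qed.

(** The state at a loop test: registers 6 and 7 are compared by [While], and register 15 is the
    final divisor of Y. *)
Definition ready st s Y x :=
  [/\ core st s Y x, sreg st 6 = dot b Y,
      sreg st 7 = s * dual_gauge wp wm (A^T *m Y) &
      sreg st 15 = dual_gauge wp wm (A^T *m Y)].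

Lemma run_gauge_code st s Y x :
  core st s Y x -> ready (run A (rcons gauge_code (NSum 6 2)) st) s Y x.
Proof.
move=> hcore; set st' := run _ _ _.
have hq : sreg st' 15 = dual_gauge wp wm (A^T *m Y).
  have -> : sreg st' 15 = Num.max
      (qfun (map2_mx (eval_bin Div) (ereg st 3) (ereg st 0%N)))
      (qfun (map2_mx (eval_bin Defs.Sub) (ereg st 20)
               (map2_mx (eval_bin Div) (ereg st 3) (ereg st 1%N)))) by [].
  case: hcore => _ _ _ _ _ _ _ -> -> _ -> ->; congr (Num.max _ _).
    by apply: eq_bigr => i _; rewrite mxE.
  by apply: eq_bigr => i _; rewrite mxE /= !mxE sub0r.
split=> //; first by case: hcore => *; split.
- have -> : sreg st' 6 = \sum_i map2_mx (eval_bin Mul) (nreg st 0%N) (nreg st 1%N) i 0.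
    by [].
  rewrite (core_b hcore) (core_Y hcore).
  by apply: eq_bigr => i _; rewrite mxE.
- have -> : sreg st' 7 = sreg st 5 * sreg st' 15 by [].
  by rewrite hq (core_s hcore).
Qed.

Lemma branch_exec st s Y x :
  core st s Y x ->
  exists st' s' Y' x',
    [/\ exec A O branch st st' 0 3, core st' s' Y' x' &
        (s', Y', x') = if sreg st 8 <= sreg st 11
          then (s / (1 + e), Y, ereg st 4 + ereg st 8)
          else (s, Y + nreg st 3, x)].
Proof.
case=> k1 k2 k3 k4 k5 k6 k7 k8 k9 k10 k11 k12.
have hT := exec_instrs A O [:: EBin Add 2 4 8] (SBin Div 5 5 13) st.
have hF := exec_instrs A O [:: NBin Add 1 1 3] (MulAT 3 1) st.
case: leP => ht.
  exists (run A [:: EBin Add 2 4 8; SBin Div 5 5 13] st), (s / (1 + e)), Y,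
    (ereg st 4 + ereg st 8).
  split=> //; first exact: exec_if_true ht hT.
  split=> //; first by rewrite -k4 -k5.
exists (run A [:: NBin Add 1 1 3; MulAT 3 1] st), s, (Y + nreg st 3), x.
have hY : map2_mx +%R (nreg st 1%N) (nreg st 3) = Y + nreg st 3.
  by rewrite k7; apply/matrixP => i j; rewrite !mxE.
split=> //; first exact: exec_if_false ht hF.
by split=> //; rewrite -hY.
Qed.

Lemma call_exec st s Y x :
  core st s Y x ->
  let f := s *: grad_flow wp wm eta (A^T *m Y) in
  let xy := O wm (b - A *m f) in
  exists st', [/\ exec A O (block flow_code (block demand_code (Call 1 2 4 3)))
                      st st' 1 22,
    core st' s Y x, ereg st' 8 = f, ereg st' 4 = xy.1 & nreg st' 3 = xy.2].
Proof.
move=> hcore f xy; have [c0 hf0] := run_flow_code hcore.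
have [c1 hf hd] := run_demand_code c0; rewrite hf0 -/f in hf hd.
set st1 := run A demand_code _ in c1 hf hd.
have hcall : exec A O (Call 1 2 4 3) st1 (set_n (set_e st1 4 xy.1) 3 xy.2) 1 1.
  by have := exec_call A O 1 2 4 3 st1; rewrite hd (core_wm c1).
exists (set_n (set_e st1 4 xy.1) 3 xy.2).
have := exec_block (exec_block hcall).
move: st1 c1 hf {hd hcall} => st1 [*]; split=> //; exact: Core.
Qed.

(** 22 for flow, demand and call, 6 for the norm, 3 for the branch and 9 for the gauge and b.Y. *)
Definition body_ops : nat := 40.

Lemma loop_body_exec st s Y x :
  ready st s Y x ->
  let f := s *: grad_flow wp wm eta (A^T *m Y) in
  let xy := O wm (b - A *m f) in
  exists st', exec A O loop_body st st' 1 body_ops /\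
    if lam * (\sum_i wm i 0 * `|xy.1 i 0|) <= e * s
    then ready st' (s / (1 + e)) Y (xy.1 + f)
    else ready st' s (Y + xy.2) x.
Proof.
case=> hcore _ _ _ f xy.
have [st2 [he2 c2 hf2 hx2 hy2]] := call_exec hcore.
have [c3 h8 h11 [hx3 hf3 hy3]] := run_norm_code c2.
have he3 P := @exec_block _ _ _ A O norm_code P st2.
move: (run A norm_code st2) c3 h8 h11 hx3 hf3 hy3 he3.
rewrite hf2 hx2 hy2 => st3 c3 h8 h11 hx3 hf3 hy3 he3.
have [st4 [s' [Y' [x' [he4 hc hcase]]]]] := branch_exec c3.
rewrite hx3 hf3 hy3 h8 h11 in hcase.
exists (run A (rcons gauge_code (NSum 6 2)) st4); split.
  have he5 := exec_instrs A O gauge_code (NSum 6 2) st4.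
  exact: exec_seq he2 (he3 _ _ _ _ (exec_seq he4 he5)).
by move: hcase (run_gauge_code hc); case: ifP => _ [-> -> ->].
Qed.

End Simulation.

(** * The computed asymmetry ratio, the initial phase and the output code *)

(** The value lam computed by [init_code]: [EMax] starts from 0, and the maximum with 1 is taken
    afterwards. *)
Definition asym_ratio (R : realType) (m : nat) (wp wm : 'cV[R]_m) : R :=
  Num.max (qfun (map2_mx (eval_bin Div) wp wm)) 1.

Lemma asym_ratio_ge1 (R : realType) (m : nat) (wp wm : 'cV[R]_m) :
  1 <= asym_ratio wp wm.
Proof. by rewrite le_max lexx orbT. Qed.

Lemma asym_ratio_le (R : realType) (m : nat) (wp wm : 'cV[R]_m) :
  asym_ratio wp wm <= asymmetry wp wm.
Proof.
have h1 : 1 <= asymmetry wp wm by exact: bigmax_ge_id.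
rewrite ge_max h1 andbT; apply: bigmax_le; first exact: le_trans ler01 h1.
by move=> i _; rewrite mxE; apply: (le_bigmax _ (fun i => wp i 0 / wm i 0)).
Qed.

Lemma wp_le_asym_ratio (R : realType) (m : nat) (wp wm : 'cV[R]_m) i :
  0 < wm i 0 -> wp i 0 <= asym_ratio wp wm * wm i 0.
Proof.
move=> hw; rewrite -ler_pdivrMr // le_max; apply/orP; left.
have := le_bigmax 0 (fun i => map2_mx (eval_bin Div) wp wm i 0) i.
by rewrite mxE.
Qed.

Lemma run_init_code (R : realType) (n m : nat) (A : 'M[R]_(n, m))
    (eps alpha : R) (wp wm : 'cV[R]_m) (b : 'cV[R]_n) :
  let lam := asym_ratio wp wm in
  let e := eps / 3 in
  let st := run A init_code (init_state eps alpha wp wm b) in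
  core A wp wm b lam e (e / (4 * (alpha * lam))) st 0 0 0 /\
  [/\ sreg st 6 = 0, sreg st 7 = 0, sreg st 14 = 0 & sreg st 15 = 0].
Proof.
move=> lam e st; split=> //; split=> //; last by rewrite mulmx0.
Qed.

Lemma run_cost_code (R : realType) (n m : nat) (A : 'M[R]_(n, m))
    (wp wm : 'cV[R]_m) (b : 'cV[R]_n) (lam e eta s : R) st Y x :
  core A wp wm b lam e eta st s Y x ->
  core A wp wm b lam e eta (run A (rcons cost_code (ESum 5 4)) st)
    (asym_cost wp wm x) Y x.
Proof.
move=> hcore; set st' := run _ _ _.
have hs : sreg st' 5 = asym_cost wp wm x.
  have -> : sreg st' 5 =
    \sum_i map2_mx (eval_bin Add)
      (map2_mx (eval_bin Max) (ereg st 20)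
         (map2_mx (eval_bin Mul) (ereg st 0%N) (ereg st 2)))
      (map2_mx (eval_bin Max) (ereg st 20)
         (map2_mx (eval_bin Defs.Sub) (ereg st 20)
           (map2_mx (eval_bin Mul) (ereg st 1%N) (ereg st 2)))) i 0 by [].
  case: hcore => _ _ _ _ _ _ _ -> -> -> _ ->.
  rewrite asym_costE; apply: eq_bigr => i _.
  by do 4 rewrite ?mxE /=; rewrite sub0r.
by case: hcore => *; split.
Qed.

Lemma dual_gauge0 (R : realType) (m : nat) (wp wm : 'cV[R]_m) :
  dual_gauge wp wm 0 = 0.
Proof.
have max0 (F : 'I_m -> R) : (forall i, F i = 0) -> \big[Num.max/0]_i F i = 0.
  move=> F0; apply: (big_ind (fun z => z = 0)) => // x y -> ->.
  exact: maxxx.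
by rewrite /dual_gauge !max0 ?maxxx // => i; rewrite mxE mul0r ?oppr0.
Qed.

Lemma init_exec (R : realType) (n m : nat) (A : 'M[R]_(n, m))
    (O : oracle_type R n m) (eps alpha : R) (wp wm : 'cV[R]_m) (b : 'cV[R]_n) :
  let lam := asym_ratio wp wm in
  let e := eps / 3 in
  let xy := O wm b in
  exists st, [/\ exec A O init_prog (init_state eps alpha wp wm b) st 1 19,
    ready A wp wm b lam e (e / (4 * (alpha * lam))) st
      (asym_cost wp wm xy.1) 0 xy.1,
    sreg st 14 = 0 & nreg st 3 = xy.2].
Proof.
move=> lam e xy; have [c1] := run_init_code A eps alpha wp wm b.
have he1 P := @exec_block _ _ _ A O init_code P (init_state eps alpha wp wm b).
move: (run A init_code _) c1 he1 => st1 c1 he1 [h6 h7 h14 h15].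
pose st2 := set_n (set_e st1 2 xy.1) 3 xy.2.
have hcall : exec A O (Call 1 0 2 3) st1 st2 1 1.
  by have := exec_call A O 1 0 2 3 st1; rewrite (core_wm c1) (core_b c1).
have c2 : core A wp wm b lam e (e / (4 * (alpha * lam))) st2 0 0 xy.1.
  by case: c1 => *; split.
have he3 := exec_instrs A O cost_code (ESum 5 4) st2.
exists (run A (rcons cost_code (ESum 5 4)) st2); split=> //.
  exact: he1 _ _ _ _ (exec_seq hcall he3).
have c3 := run_cost_code c2; split=> //.
(* Because Y = 0, registers 6, 7 and 15 already hold the right values, namely their initial 0. *)
- by rewrite [dot _ _]big1 => [|i _]; [exact: h6|rewrite mxE mulr0].
- by rewrite mulmx0 dual_gauge0 mulr0; exact: h7.
- by rewrite mulmx0 dual_gauge0; exact: h15.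
Qed.

Lemma run_final (R : realType) (n m : nat) (A : 'M[R]_(n, m)) (st : state R n m) :
  let st' := run A [:: EBin Max 0 2 2; NFill 2 15; NBin Div 0 1 2] st in
  out_x st' = ereg st 2 /\ out_y st' = (sreg st 15)^-1 *: nreg st 1%N.
Proof.
split.
  transitivity (map2_mx (eval_bin Max) (ereg st 2) (ereg st 2)); first by [].
  by apply/matrixP => i j; rewrite mxE /= maxxx.
transitivity (map2_mx (eval_bin Div) (nreg st 1%N) (const_mx (sreg st 15))).
  by [].
by apply/matrixP => i j; rewrite !mxE /= mulrC.
Qed.

Lemma run_trivial (R : realType) (n m : nat) (A : 'M[R]_(n, m)) (st : state R n m) :
  let st' := run A [:: EBin Max 0 2 2; NBin Max 0 3 3] st in
  out_x st' = ereg st 2 /\ out_y st' = nreg st 3.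
Proof.
split.
  transitivity (map2_mx (eval_bin Max) (ereg st 2) (ereg st 2)); first by [].
  by apply/matrixP => i j; rewrite mxE /= maxxx.
transitivity (map2_mx (eval_bin Max) (nreg st 3) (nreg st 3)); first by [].
by apply/matrixP => i j; rewrite mxE /= maxxx.
Qed.

(** * Graph facts and the numerical bound on iterations *)

(** Each column has one entry 1 and one entry -1. Hence every residual demand is a legal query. *)
Lemma incidence_mul_sum0 (R : realType) (n m : nat) (G : graph n m)
    (x : 'cV[R]_m) : \sum_i (incidence R G *m x) i 0 = 0.
Proof.
have delta (j : 'I_n) : \sum_i (i == j)%:R = 1 :> R.
  by rewrite (bigD1 j) //= eqxx big1 ?addr0 // => i /negPf ->.
rewrite (eq_bigr (fun i => \sum_e incidence R G i e * x e 0)); last first.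
  by move=> i _; rewrite mxE.
rewrite exchange_big big1 //= => e _; rewrite -mulr_suml.
by rewrite (eq_bigr _ (fun i _ => mxE _ _ i e)) sumrB !delta subrr mul0r.
Qed.

Lemma graph_edges_le (n m : nat) (G : graph n m) : (m <= n ^ 2)%N.
Proof.
have inj : injective (fun e => (etail G e, ehead G e)).
  by move=> e f [h1 h2]; apply: (graph_simple (g := G)); rewrite h1 h2.
by have := leq_card _ inj; rewrite card_prod !card_ord.
Qed.

Lemma ln_edges_le (R : realType) (n m : nat) (G : graph n m) :
  (0 < m)%N -> ln (m%:R : R) <= 2 * ln n%:R.
Proof.
move=> hm; have hn := graph_nonempty G.
have n0 : 0 < n%:R :> R by rewrite ltr0n.
rewrite mulr_natl -lnXn // ler_ln ?posrE ?ltr0n ?exprn_gt0 //.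
by rewrite -natrX ler_nat graph_edges_le.
Qed.

Lemma iteration_bound_le (R : realType) (m n : nat) (alpha lam lam' eps : R) :
  1 <= alpha -> 1 <= lam -> lam <= lam' -> 0 < eps <= 1 ->
  0 <= ln (n%:R : R) -> ln (m%:R : R) <= 2 * ln n%:R ->
  iteration_bound m alpha lam (eps / 3)
    <= 156 * (1 + ln n%:R) * (eps ^- 3 * alpha ^+ 2 * lam' ^+ 4).
Proof.
rewrite /iteration_bound => ha hl hl' /andP[e0 e1].
move: (ln n%:R) (ln m%:R) => l' l h0 hll.
set t := eps^-1; have t1 : 1 <= t by rewrite invf_ge1.
have -> : eps ^- 3 = t ^+ 3 by rewrite exprVn.
(* The factors are 72 = 8 * 3^2 and 12 = 4 * 3, from e = eps / 3; since lam + ln m is at most 2 (1 +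
   ln n) lam'^2, the total is 72 * 2 + 12 = 156. *)
have -> : 8 * (alpha * lam) ^+ 2 * (lam + l) / (eps / 3) ^+ 2
    + 4 * (alpha * lam) / (eps / 3)
  = 72 * (alpha ^+ 2 * (lam ^+ 2 * (lam + l)) * t ^+ 2)
    + 12 * (alpha * lam * t).
  by rewrite /t; field; rewrite gt_eqF.
have [a0 l0 l1' t0] : [/\ 0 <= alpha, 0 <= lam, 1 <= lam' & 0 <= t] by split; lra.
have L0 : 0 <= lam' by lra.
have le_sq (z : R) : 1 <= z -> z <= z ^+ 2 by move=> hz; rewrite expr2 ler_peMl //; lra.
have i1 : alpha * lam * t <= alpha ^+ 2 * lam' ^+ 4 * t ^+ 3.
  apply: ler_pM; rewrite ?mulr_ge0 //; last by rewrite -[leLHS]expr1 ler_weXn2l.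
  apply: ler_pM => //; first exact: le_sq.
  by apply: (le_trans hl'); rewrite -[leLHS]expr1 ler_weXn2l.
have i2 : lam ^+ 2 * (lam + l) <= lam' ^+ 4 * (2 * (1 + l')).
  have j1 : lam + l <= lam' ^+ 2 * (2 * (1 + l')).
    have k1 := le_trans hl' (le_sq _ l1').
    have k2 : 1 <= lam' ^+ 2 by rewrite exprn_ege1.
    have k3 := ler_wpM2r h0 k2.
    lra.
  have j2 : lam ^+ 2 <= lam' ^+ 2 by rewrite lerXn2r ?nnegrE.
  have j3 : 0 <= lam' ^+ 2 * (2 * (1 + l')).
    by rewrite mulr_ge0 ?exprn_ge0 //; lra.
  have -> : lam' ^+ 4 * (2 * (1 + l')) = lam' ^+ 2 * (lam' ^+ 2 * (2 * (1 + l'))).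
    by ring.
  apply: (le_trans (ler_wpM2l (exprn_ge0 2 l0) j1)).
  exact: ler_wpM2r j3 _ _ j2.
set X := t ^+ 3 * alpha ^+ 2 * lam' ^+ 4.
have X0 : 0 <= X by rewrite !mulr_ge0 ?exprn_ge0.
have i3 : alpha ^+ 2 * (lam ^+ 2 * (lam + l)) * t ^+ 2 <= 2 * (1 + l') * X.
  apply: (@le_trans _ _ (alpha ^+ 2 * (lam' ^+ 4 * (2 * (1 + l'))) * t ^+ 2)).
    by rewrite ler_wpM2r ?exprn_ge0 // ler_wpM2l ?exprn_ge0.
  have -> : 2 * (1 + l') * X
    = alpha ^+ 2 * (lam' ^+ 4 * (2 * (1 + l'))) * t ^+ 3 by rewrite /X; ring.
  rewrite ler_wpM2l ?ler_weXn2l // mulr_ge0 ?exprn_ge0 // mulr_ge0 ?exprn_ge0 //.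
  lra.
have i4 : alpha * lam * t <= X.
  by apply: (le_trans i1); rewrite /X le_eqVlt; apply/orP; left; apply/eqP; ring.
have i5 := mulr_ge0 h0 X0.
lra.
Qed.

(** * Assembling the loop and the whole program *)

Lemma while_loop_exec (R : realType) (n m : nat) (A : 'M[R]_(n, m))
    (O : oracle_type R n m) (wp wm : 'cV[R]_m) (b : 'cV[R]_n)
    (alpha lam e eta s0 : R) (y0 : 'cV[R]_n) (x0 : 'cV[R]_m) st :
  (0 < m)%N -> (forall i, 1 <= wm i 0) -> (forall i, wm i 0 <= wp i 0) ->
  1 <= alpha -> 1 <= lam -> (forall i, wp i 0 <= lam * wm i 0) ->
  0 < e -> e <= 1 -> eta = e / (4 * (alpha * lam)) -> 0 < s0 ->
  (forall i, `|(A^T *m y0) i 0| <= wm i 0) -> s0 <= lam * alpha * dot b y0 ->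
  (forall x : 'cV[R]_m, \sum_i (A *m x) i 0 = 0) -> \sum_i b i 0 = 0 ->
  approx_oracle A alpha O -> A *m x0 = b -> asym_cost wp wm x0 = s0 ->
  ready A wp wm b lam e eta st s0 0 x0 ->
  exists st' N, [/\
    exec A O (Seq (While 6 7 loop_body) final_prog) st st' N (N * 41 + 4),
    A *m out_x st' = b, asym_dual_feasible A wp wm (out_y st'),
    asym_cost wp wm (out_x st') <= (1 + 3 * e) * dot b (out_y st') &
    N%:R <= 1 + Num.max 0 (iteration_bound m alpha lam e)].
Proof.
move=> m0 wm1 wmp a1 l1 hlam e0 e1 etaE s00 hy0 hs0 Asum bsum hO hx0 hc0 hst.
have wm0 i : 0 < wm i 0 by exact: lt_le_trans ltr01 (wm1 i).
(* Only the total k1 + k2 is visible to the loop rule, as each round performs exactly one of the two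
   steps. *)
pose I k st := exists k1 k2 s Y x, [/\ k = (k1 + k2)%N,
  loop_inv A wp wm b e eta s0 k1 k2 s Y x & ready A wp wm b lam e eta st s Y x].
have hI0 : I 0%N st.
  exists 0%N, 0%N, s0, 0, x0; split=> //; split=> //.
  - by rewrite mulr1.
  - by rewrite hc0 ler_peMl ?(ltW s00) // exprn_ege1 //; lra.
  - rewrite mulmx0 potential0 // [dot _ _]big1 => [|i _]; last by rewrite mxE mulr0.
    by rewrite mul0r !mulr0 subrr expR0 mulr1.
have [|st1 [k [N [hex [k1 [k2 [s [Y [x [_ hinv hr]]]]]] hexit hN]]]] :=
  @exec_while_bounded R n m A O 6 7 loop_body body_ops
    (iteration_bound m alpha lam e) I _ st hI0.
  move=> k st1 [k1 [k2 [s [Y [x [-> hinv hr]]]]]] htest; split.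
    case: (hr) => _ h6 h7 _; rewrite h6 h7 in htest.
    exact: (inv_bound m0 wm0 wmp a1 l1 hlam e0 e1 etaE hy0 hs0 hinv htest).
  have [st2 [hex hcase]] := loop_body_exec O hr.
  exists st2; split=> //; move: hcase.
  set f := grad_flow _ _ _ _; set xy := O _ _.
  have hxy : sym_approx A alpha wm (b - A *m (s *: f)) xy.1 xy.2.
    apply: hO => //; rewrite (eq_bigr (fun i => b i 0 - (A *m (s *: f)) i 0)).
      by rewrite sumrB bsum Asum subrr.
    by move=> i _; rewrite !mxE.
  case: leP => ht hr2.
    exists k1, k2.+1, (s / (1 + e)), Y, (xy.1 + s *: f); split=> //.
      by rewrite addnS.
    exact: (inv_primal_step m0 wm0 wmp a1 l1 hlam e0 e1 etaE hinv hxy).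
  exists k1.+1, k2, s, (Y + xy.2), x; split=> //.
  exact: (inv_dual_step m0 wm0 wmp a1 l1 e0 e1 etaE hinv hxy).
case: hr => hcore h6 h7 h15; rewrite h6 h7 in hexit.
have [hdual hcost] := inv_exit wm0 wmp e0 e1 hinv hexit.
have [hox hoy] := run_final A st1.
have hfin := exec_instrs A O [:: EBin Max 0 2 2; NFill 2 15] (NBin Div 0 1 2) st1.
rewrite (core_x hcore) in hox; rewrite h15 (core_Y hcore) in hoy.
exists (run A [:: EBin Max 0 2 2; NFill 2 15; NBin Div 0 1 2] st1), N.
rewrite hox hoy; split=> //; last exact: inv_feasible hinv.
have := exec_seq hex hfin; rewrite addn0 -addnA; exact.
Qed.

Theorem mainTheorem11 (R : realType) :
  exists (P : prog) (C : R) (k : nat),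
  forall (n m : nat) (G : graph n m)
         (wplus wminus : 'I_m -> nat) (demand : 'I_n -> int)
         (alpha eps : R) (O : oracle_type R n m),
  let A := incidence R G in
  let wp : 'cV[R]_m := \col_e (wplus e)%:R in
  let wm : 'cV[R]_m := \col_e (wminus e)%:R in
  let b : 'cV[R]_n := \col_i (demand i)%:~R in
  (forall e, (1 <= wminus e <= wplus e)%N) ->
  \sum_i demand i = 0 ->
  1 <= alpha ->
  0 < eps <= 1 ->
  approx_oracle A alpha O ->
  exists (st : state R n m) (calls ops : nat),
    [/\ exec A O P (init_state eps alpha wp wm b) st calls ops,
        asym_primal_feasible A b (out_x st),
        asym_dual_feasible A wp wm (out_y st),
        asym_cost wp wm (out_x st) <= (1 + eps) * dot b (out_y st) &
        calls%:R <= call_bound C k n eps alpha (asymmetry wp wm) /\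
        ops%:R <= call_bound C k n eps alpha (asymmetry wp wm)].
Proof.
(* The operation count 41 N + 24 with N <= 1 + 156 (1 + ln n) X needs a constant of at least 41 *
   157 + 24 = 6461. *)
exists transshipment_prog, (100 * 100), 1%N.
move=> n m G wplus wminus demand alpha eps O A wp wm b hw hdem ha heps hO.
have wm1 i : 1 <= wm i 0 by rewrite mxE ler1n; case/andP: (hw i).
have wmp i : wm i 0 <= wp i 0 by rewrite !mxE ler_nat; case/andP: (hw i).
have wm0 i : 0 < wm i 0 by exact: lt_le_trans ltr01 (wm1 i).
have bsum : \sum_i b i 0 = 0.
  rewrite (eq_bigr (fun i => (demand i)%:~R)) => [|i _]; last by rewrite mxE.
  by rewrite -rmorph_sum hdem.
have Asum (x : 'cV[R]_m) : \sum_i (A *m x) i 0 = 0 by exact: incidence_mul_sum0.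
have [e0 e1] := andP heps.
have ln0 : 0 <= ln (n%:R : R) by rewrite ln_ge0 // ler1n (graph_nonempty G).
set X := eps ^- 3 * alpha ^+ 2 * asymmetry wp wm ^+ 4.
have l1 := asym_ratio_ge1 wp wm; have l1' := asym_ratio_le wp wm.
(* This absorbs the additive constants into the bound. *)
have X1 : 1 <= X.
  have t1 : 1 <= eps ^- 3 by rewrite -exprVn exprn_ege1 // invf_ge1.
  have t2 : 1 <= alpha ^+ 2 by rewrite exprn_ege1.
  have t3 : 1 <= asymmetry wp wm ^+ 4 by rewrite exprn_ege1 // (le_trans l1).
  by rewrite -[leLHS]mulr1 ler_pM // -[leLHS]mulr1 ler_pM.
have XL : X <= (1 + ln n%:R) * X.
  by rewrite ler_peMl ?(le_trans ler01) // lerDl.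
have boundE : call_bound (100 * 100) 1 n eps alpha (asymmetry wp wm)
    = 100 * 100 * ((1 + ln n%:R) * X) by rewrite /call_bound expr1 mulrA.
have [st [hinit hready h14 hy0]] := init_exec A O eps alpha wp wm b.
move: hready; set xy := O wm b in hy0 *; set s0 := asym_cost wp wm xy.1.
set lam := asym_ratio wp wm in l1 l1' *; set e := eps / 3 => hready.
have [hx hyf hxy] : sym_approx A alpha wm b xy.1 xy.2 by exact: hO.
have hyb := sym_dual_feasible_edge wm0 hyf.
rewrite norm1_diagw // in hxy.
have hlam i : wp i 0 <= lam * wm i 0 by exact: wp_le_asym_ratio.
have s0_le : s0 <= lam * alpha * dot b xy.2.
  apply: (le_trans (asym_cost_le_norm wm0 wmp xy.1 l1 hlam)).
  by rewrite -mulrA ler_wpM2l // (le_trans ler01).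
have [hcore _ _ _] := hready.
(* If the first flow costs nothing, b.y >= 0 already makes the first pair a solution. *)
have [hs|hs] := leP s0 0.
  have hdot : 0 <= dot b xy.2.
    have h : 0 <= alpha * dot b xy.2.
      apply: le_trans hxy; apply: sumr_ge0 => i _.
      by rewrite mulr_ge0 // ltW.
    by rewrite pmulr_rge0 // in h; apply: lt_le_trans ha.
  have hbr := exec_instrs A O [:: EBin Max 0 2 2] (NBin Max 0 3 3) st.
  have htest : sreg st 5 <= sreg st 14 by rewrite (core_s hcore) h14.
  have [hox hoy] := run_trivial A st.
  rewrite (core_x hcore) in hox; rewrite hy0 in hoy.
  have hex := exec_seq hinit
    (exec_if_true (Seq (While 6 7 loop_body) final_prog) htest hbr).
  exists (run A [:: EBin Max 0 2 2; NBin Max 0 3 3] st), 1%N, 22%N.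
  rewrite hox hoy; split=> //.
  - apply: (asym_dual_feasibleP wm0 wmp) => i.
    move: (hyb i); rewrite ler_norml => /andP[-> h] /=.
    exact: le_trans h (wmp i).
  - by apply: (le_trans hs); rewrite mulr_ge0 //; lra.
  - by rewrite boundE; split; lra.
(* Without edges every cost is 0, against s0 > 0. *)
have m0 : (0 < m)%N.
  rewrite lt0n; apply/eqP => m0; move: hs; rewrite /s0 asym_costE big1 ?ltxx //.
  by move=> i; have := ltn_ord i; rewrite {2}m0.
have he0 : 0 < e by rewrite /e; lra.
have he1 : e <= 1 by rewrite /e; lra.
have [st' [N [hex hox hoy hcost hN]]] := while_loop_exec m0 wm1 wmp ha l1 hlam
  he0 he1 erefl hs hyb s0_le Asum bsum hO hx erefl hready.
have htest : sreg st 14 < sreg st 5 by rewrite (core_s hcore) h14.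
have hB := iteration_bound_le ha l1 l1' heps ln0 (ln_edges_le R G m0).
rewrite -/X -mulrA in hB.
have hN2 : N%:R <= 1 + 156 * ((1 + ln n%:R) * X).
  apply: (le_trans hN); rewrite lerD2l ge_max hB andbT.
  by rewrite mulr_ge0 // (le_trans _ XL) // (le_trans ler01).
exists st', (1 + N)%N, (N * 41 + 24)%N; split=> //.
- have -> : (N * 41 + 24 = 19 + (N * 41 + 4).+1)%N by rewrite -addnS addnCA.
  exact: exec_seq hinit (exec_if_false _ htest hex).
- by have -> : 1 + eps = 1 + 3 * e by rewrite /e; field.
- rewrite boundE; split; first by rewrite natrD; lra.
  by rewrite natrD natrM; lra.
Qed.
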